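(* Let $K$ be a complete discretely valued field with ring of integers $\mathcal{O}_K$, uniformiser $\pi$ and residue field $\mathbb{F}$. Let $\rho\colon G\to\mathrm{GL}(V)$ be a representation of a group $G$ on a finite-dimensional $K$-vector space $V$. Let $v\in V$ be nonzero and let $\Lambda\in\mathcal{L}_v$. The following are equivalent: (i) $\Lambda$ is maximal with respect to $v$; (ii) the socle of the $\mathbb{F}[G]$-module $\Lambda/\pi\Lambda$ is irreducible and is generated by the image of $v$.
   Context: A lattice in $V$ is a free $\mathcal{O}_K$-submodule of rank $\dim_K V$; it is $\rho(G)$-stable if $\rho(g)\Lambda=\Lambda$ for all $g\in G$. A lattice $\Lambda$ is normalised at $v$ if $v\in\Lambda$ and the image of $v$ in $\Lambda/\pi\Lambda$ is nonzero. $\mathcal{L}_v$ is the set of $\rho(G)$-stable lattices normalised at $v$, partially ordered by inclusion; $\Lambda$ is maximal with respect to $v$ if it is a maximal element of $\mathcal{L}_v$. *)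

(* Defs.v *)
From HB Require Import structures.
From mathcomp Require Import all_boot all_order all_algebra.
From mathcomp Require Import generic_quotient ring_quotient.
From mathcomp Require Import boolp classical_sets.

Set Implicit Arguments.
Unset Strict Implicit.
Unset Printing Implicit Defensive.

Import Order.TTheory GRing.Theory Num.Theory.
Local Open Scope classical_set_scope.
Local Open Scope quotient_scope.
Local Open Scope ring_scope.

(* A normalised discrete valuation; its value at 0 is junk, the convention
   w 0 = +oo being implemented by [val_ge] below. *)
Record discrete_valuation (K : fieldType) := DiscreteValuation {
  valuation :> K -> int;
  valuationM : forall x y, x != 0 -> y != 0 ->
    valuation (x * y) = valuation x + valuation y;
  valuationD : forall x y, x != 0 -> y != 0 -> x + y != 0 ->
    Num.min (valuation x) (valuation y) <= valuation (x + y);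
  valuation_surj : forall n : int, exists2 x, x != 0 & valuation x = n
}.

Section DVR.
Variables (K : fieldType) (w : discrete_valuation K).

Definition val_ge (n : int) : {pred K} := [pred x | (x == 0) || (n <= w x)].

Definition valuation_cauchy (u : nat -> K) : Prop :=
  forall N : int, exists n0 : nat, forall m n : nat,
    (n0 <= m)%N -> (n0 <= n)%N -> u m - u n \in val_ge N.

Definition valuation_cvg (u : nat -> K) (l : K) : Prop :=
  forall N : int, exists n0 : nat, forall n : nat,
    (n0 <= n)%N -> u n - l \in val_ge N.

Definition valuation_complete : Prop :=
  forall u, valuation_cauchy u -> exists l, valuation_cvg u l.

Lemma valuation1 : w 1 = 0.
Proof.
have := valuationM w (oner_neq0 K) (oner_neq0 K).
by rewrite mulr1 -[LHS]addr0 => /addrI.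
Qed.

Lemma valuationN x : w (- x) = w x.
Proof.
have [->|x0] := eqVneq x 0; first by rewrite oppr0.
have N10 : (-1 : K) != 0 by rewrite oppr_eq0 oner_neq0.
have := valuationM w N10 N10; rewrite mulrNN mulr1 valuation1 => /esym/eqP.
rewrite -mulr2n mulrn_eq0 /= => /eqP h.
by rewrite -mulN1r valuationM // h add0r.
Qed.

Lemma val_geD n x y : x \in val_ge n -> y \in val_ge n -> x + y \in val_ge n.
Proof.
rewrite !inE; have [->|x0] := eqVneq x 0; first by rewrite add0r.
have [->|y0] := eqVneq y 0; first by rewrite addr0 (negPf x0).
have [//|s0 /= nx ny] := eqVneq (x + y) 0.
by apply: le_trans (valuationD w x0 y0 s0); rewrite le_min nx.
Qed.

Lemma val_geN n x : x \in val_ge n -> - x \in val_ge n.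
Proof. by rewrite !inE oppr_eq0 valuationN. Qed.

Lemma val_geM m n x y :
  x \in val_ge m -> y \in val_ge n -> x * y \in val_ge (m + n).
Proof.
rewrite !inE; have [->|x0] := eqVneq x 0; first by rewrite mul0r eqxx.
have [->|y0] := eqVneq y 0; first by rewrite mulr0 eqxx.
by rewrite mulf_eq0 (negPf x0) (negPf y0) valuationM //=; apply: lerD.
Qed.

Lemma val_ge_subring : subring_closed (val_ge 0).
Proof.
split=> [|x y hx hy|x y hx hy].
- by rewrite inE valuation1 lexx orbT.
- by apply: val_geD => //; apply: val_geN.
- by have := val_geM hx hy; rewrite addr0.
Qed.

HB.instance Definition _ :=
  GRing.isSubringClosed.Build K (val_ge 0) val_ge_subring.

Record integers := Integer { int_val : K; _ : int_val \in val_ge 0 }.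

HB.instance Definition _ := [isSub for int_val].
HB.instance Definition _ := [Choice of integers by <:].
HB.instance Definition _ := [SubChoice_isSubComNzRing of integers by <:].

Definition max_ideal : {pred integers} := [pred x | int_val x \in val_ge 1].

Lemma max_ideal_closed : idealr_closed max_ideal.
Proof.
split=> [||a x y hx hy].
- by rewrite !inE eqxx.
- by rewrite !inE /= oner_eq0 valuation1.
rewrite inE; apply: val_geD => //.
by have := val_geM (valP a) hx; rewrite add0r.
Qed.

HB.instance Definition _ := isIdealr.Build integers max_ideal max_ideal_closed.

Definition residue_field := {ideal_quot max_ideal}.

HB.instance Definition _ := GRing.ComNzRing.on residue_field.
HB.instance Definition _ := @NzRingQuotient.on residue_field.

Lemma integer_inv_subproof (x : integers) :
  (if w (int_val x) == 0 then (int_val x)^-1 else 0) \in val_ge 0.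
Proof.
case: eqP => [wx|_]; last by rewrite inE eqxx.
have [->|x0] := eqVneq (int_val x) 0; first by rewrite invr0 inE eqxx.
have xV0 : (int_val x)^-1 != 0 by rewrite invr_eq0.
have := valuationM w x0 xV0; rewrite divff // valuation1 wx add0r => h.
by rewrite inE -h lexx orbT.
Qed.

Definition integer_inv (x : integers) : integers :=
  Integer (integer_inv_subproof x).

Definition residue_inv (a : residue_field) : residue_field :=
  if a == 0 then 0 else \pi_residue_field (integer_inv (repr a)).

Lemma residue_eq0 (x : integers) :
  (\pi_residue_field x == 0) = (x \in max_ideal).
Proof.
by rewrite -[0](raddf0 \pi_residue_field) -Quotient.idealrBE subr0.
Qed.

Lemma residue_mulVf (a : residue_field) : a != 0 -> residue_inv a * a = 1.
Proof.
move=> a0; rewrite /residue_inv (negPf a0).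
have ax : a = \pi_residue_field (repr a) by rewrite reprK.
rewrite {2}ax -rmorphM -[RHS](rmorph1 \pi_residue_field); congr (\pi_residue_field _).
move: a0; rewrite {1}ax residue_eq0; move: (repr a) => x {a ax}.
rewrite inE /= negb_or -ltNge => /andP[x0 wx1].
have wx : w (int_val x) = 0.
  have := valP x; rewrite inE (negPf x0) /= => wx0.
  by apply/eqP; rewrite eq_le wx0 andbT -ltzD1 add0r.
by apply: val_inj; rewrite /= wx eqxx mulVf.
Qed.

Lemma residue_inv0 : residue_inv 0 = 0.
Proof. by rewrite /residue_inv eqxx. Qed.

HB.instance Definition _ :=
  GRing.ComNzRing_isField.Build residue_field residue_mulVf residue_inv0.

Record uniformiser := Uniformiser {
  unif :> integers;
  unif_neq0 : int_val unif != 0;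
  unif_val : w (int_val unif) = 1
}.

End DVR.

Arguments max_ideal {K} w.

(* G acts through GL(M): rho g is invertible with inverse rho g^-1. Over a
   field F this is the same thing as an F[G]-module structure on M. *)
Record representation (R : pzRingType) (G : groupType) (M : lmodType R) :=
  Representation {
    action :> G -> {linear M -> M};
    action1 : forall x, action 1%g x = x;
    actionM : forall g h x, action (g * h)%g x = action g (action h x)
  }.

Section Submodules.
Variables (R : pzRingType) (G : groupType) (M : lmodType R).
Variable rho : representation G M.

Definition submodule (N : set M) : Prop :=
  [/\ N 0,
      forall (a : R) x y, N x -> N y -> N (a *: x + y)
    & forall g x, N x -> N (rho g x)].

Definition irreducible_submodule (N : set M) : Prop :=
  [/\ submodule N, N <> [set 0]
    & forall N', submodule N' -> N' `<=` N -> N' = [set 0] \/ N' = N].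

(* The sum of all irreducible submodules. *)
Definition socle : set M :=
  [set x | exists (n : nat) (y : 'I_n -> M),
    (forall i, exists2 N, irreducible_submodule N & N (y i)) /\
    x = \sum_(i < n) y i].

Definition generated_submodule (x : M) : set M :=
  \bigcap_(N in [set N | submodule N /\ N x]) N.

End Submodules.

Section Lattices.
Variables (K : fieldType) (w : discrete_valuation K) (V : vectType K).

(* L is a free O_K-submodule of V with O_K-basis b, of rank dim_K V. *)
Definition is_lattice (L : set V) : Prop :=
  exists b : 'I_(\dim {:V}) -> V,
    (forall c : 'I_(\dim {:V}) -> integers w,
      \sum_i int_val (c i) *: b i = 0 -> forall i, c i = 0) /\
    L = [set x | exists c : 'I_(\dim {:V}) -> integers w,
                   x = \sum_i int_val (c i) *: b i].

Record lattice := Lattice {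
  lattice_set :> set V;
  lattice_is_lattice : is_lattice lattice_set
}.

Variable L : lattice.

Definition lattice_pred : {pred V} := [pred x | x \in (L : set V)].

Lemma lattice_predP x : reflect ((L : set V) x) (x \in lattice_pred).
Proof. by rewrite inE; apply: asboolP. Qed.

Lemma lattice_zmod_closed : zmod_closed lattice_pred.
Proof.
have [b [_ Lb]] := lattice_is_lattice L.
split=> [|x y /lattice_predP + /lattice_predP]; [apply/lattice_predP|];
  rewrite ?Lb.
- by exists (fun=> 0); rewrite big1 // => i _; rewrite scale0r.
- move=> [c ->] [d ->]; apply/lattice_predP; rewrite Lb.
  exists (fun i => c i - d i); rewrite -sumrB.
  by apply: eq_bigr => i _; rewrite -scalerBl.
Qed.

HB.instance Definition _ :=
  GRing.isZmodClosed.Build V lattice_pred lattice_zmod_closed.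

Record lattice_elt := LatticeElt {
  lat_val : V; _ : lat_val \in lattice_pred }.

HB.instance Definition _ := [isSub for lat_val].
HB.instance Definition _ := [Choice of lattice_elt by <:].
HB.instance Definition _ := [SubChoice_isSubZmodule of lattice_elt by <:].

Lemma lattice_scale_subproof (a : integers w) (x : lattice_elt) :
  int_val a *: lat_val x \in lattice_pred.
Proof.
have [b [_ Lb]] := lattice_is_lattice L.
have /lattice_predP := valP x; rewrite Lb => -[c xc].
apply/lattice_predP; rewrite Lb; exists (fun i => a * c i).
rewrite [lat_val x]xc scaler_sumr.
by apply: eq_bigr => i _; rewrite scalerA.
Qed.

Definition lattice_scale a x : lattice_elt :=
  LatticeElt (lattice_scale_subproof a x).

Fact lattice_scaleA a b x :
  lattice_scale a (lattice_scale b x) = lattice_scale (a * b) x.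
Proof. by apply: val_inj; rewrite /= scalerA. Qed.
Fact lattice_scale1 : left_id 1 lattice_scale.
Proof. by move=> x; apply: val_inj; rewrite /= scale1r. Qed.
Fact lattice_scaleDr : right_distributive lattice_scale +%R.
Proof. by move=> a x y; apply: val_inj; rewrite /= scalerDr. Qed.
Fact lattice_scaleDl x : {morph lattice_scale^~ x : a b / a + b}.
Proof. by move=> a b; apply: val_inj; rewrite /= scalerDl. Qed.

HB.instance Definition _ := GRing.Zmodule_isLmodule.Build (integers w)
  lattice_elt lattice_scaleA lattice_scale1 lattice_scaleDr lattice_scaleDl.

Variable pi : uniformiser w.

(* pi L, as a predicate on L. *)
Definition unif_mul : {pred lattice_elt} :=
  [pred x | `[< exists y : lattice_elt, x = (pi : integers w) *: y >]].

Lemma unif_mulP x :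
  reflect (exists y : lattice_elt, x = (pi : integers w) *: y) (x \in unif_mul).
Proof. by rewrite inE; apply: asboolP. Qed.

Lemma unif_mul_zmod_closed : zmod_closed unif_mul.
Proof.
split=> [|x y /unif_mulP[x' ->] /unif_mulP[y' ->]]; apply/unif_mulP.
  by exists 0; rewrite scaler0.
by exists (x' - y'); rewrite scalerBr.
Qed.

HB.instance Definition _ :=
  GRing.isZmodClosed.Build lattice_elt unif_mul unif_mul_zmod_closed.

(* L / pi L. *)
Definition reduction := {ideal_quot unif_mul}.

HB.instance Definition _ := GRing.Zmodule.on reduction.
HB.instance Definition _ := ZmodQuotient.on reduction.

Definition reduce (x : lattice_elt) : reduction := \pi_reduction x.

Lemma reduce_eq x y : (reduce x == reduce y) = (x - y \in unif_mul).
Proof. by rewrite Quotient.idealrBE. Qed.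

Lemma max_ideal_scale (a : integers w) (x : lattice_elt) :
  a \in max_ideal w -> a *: x \in unif_mul.
Proof.
rewrite inE => am; apply/unif_mulP.
have pi0 := unif_neq0 pi.
have hV : int_val a / int_val pi \in val_ge w 0.
  rewrite inE; have [->|a0] := eqVneq (int_val a) 0.
    by rewrite mul0r eqxx.
  move: am; rewrite inE (negPf a0) /= => am.
  have q0 : int_val a / int_val pi != 0 by rewrite mulf_neq0 ?invr_eq0.
  have := valuationM w q0 pi0; rewrite divfK // unif_val => wa.
  by rewrite (negPf q0) /= -(lerD2r 1) -wa add0r.
exists ((Integer hV : integers w) *: x); rewrite scalerA; congr (_ *: _).
by apply: val_inj; rewrite /= mulrC divfK.
Qed.

Definition reduction_scale (a : residue_field w) (x : reduction) : reduction :=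
  reduce (repr a *: repr x).

Lemma reduction_scaleE (a : integers w) (x : lattice_elt) :
  reduction_scale (\pi_(residue_field w) a) (reduce x) = reduce (a *: x).
Proof.
rewrite /reduction_scale; set a' := repr _; set x' := repr _.
have aE : a' - a \in max_ideal w.
  by rewrite Quotient.idealrBE /a' reprK.
have xE : x' - x \in unif_mul by rewrite Quotient.idealrBE /x' reprK.
apply/eqP; rewrite reduce_eq.
rewrite -(subrK (a *: x') (a' *: x')) -addrA -scalerBl -scalerBr.
apply: rpredD; first exact: max_ideal_scale.
have /unif_mulP[y ->] := xE; apply/unif_mulP; exists (a *: y).
by rewrite !scalerA mulrC.
Qed.

Lemma reduceD x y : reduce (x + y) = reduce x + reduce y.
Proof. exact: (raddfD \pi_reduction). Qed.

Lemma reduceK (x : reduction) : reduce (repr x) = x.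
Proof. exact: reprK. Qed.

Fact reduction_scaleA a b x :
  reduction_scale a (reduction_scale b x) = reduction_scale (a * b) x.
Proof.
rewrite -[a]reprK -[b]reprK -[x]reduceK -rmorphM.
rewrite (reduction_scaleE (repr b) (repr x)) !reduction_scaleE.
by rewrite scalerA.
Qed.
Fact reduction_scale1 : left_id 1 reduction_scale.
Proof.
move=> x; rewrite -[x]reduceK -(rmorph1 \pi_(residue_field w)).
by rewrite reduction_scaleE scale1r.
Qed.
Fact reduction_scaleDr : right_distributive reduction_scale +%R.
Proof.
move=> a x y; rewrite -[a]reprK -[x]reduceK -[y]reduceK -reduceD.
by rewrite !reduction_scaleE scalerDr reduceD.
Qed.
Fact reduction_scaleDl x : {morph reduction_scale^~ x : a b / a + b}.
Proof.
move=> a b; rewrite /= -[a]reprK -[b]reprK -[x]reduceK -rmorphD.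
by rewrite !reduction_scaleE scalerDl reduceD.
Qed.

HB.instance Definition _ := GRing.Zmodule_isLmodule.Build (residue_field w)
  reduction reduction_scaleA reduction_scale1 reduction_scaleDr
  reduction_scaleDl.

(* The image of v in L / pi L; meaningful only when v is in L. *)
Definition reduce_vec (v : V) : reduction := reduce (insubd (0 : lattice_elt) v).

End Lattices.

Arguments lattice_pred {K w V} L.
Arguments unif_mul {K w V} L pi.

Section StableLattices.
Variables (K : fieldType) (w : discrete_valuation K) (V : vectType K).
Variables (G : groupType) (rho : representation G V).

Record stable_lattice := StableLattice {
  stable_lattice_lattice :> lattice w V;
  stable_latticeP : forall g : G,
    rho g @` stable_lattice_lattice = stable_lattice_lattice
}.

Variables (pi : uniformiser w) (L : stable_lattice).

Lemma lattice_act_subproof g (x : lattice_elt L) :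
  rho g (lat_val x) \in lattice_pred L.
Proof.
apply/lattice_predP; rewrite -(stable_latticeP L g).
by exists (lat_val x) => //; apply/lattice_predP/(valP x).
Qed.

Definition lattice_act g x : lattice_elt L :=
  LatticeElt (lattice_act_subproof g x).

Definition reduction_act (g : G) (x : reduction L pi) : reduction L pi :=
  reduce pi (lattice_act g (repr x)).

Lemma reduction_actE g x :
  reduction_act g (reduce pi x) = reduce pi (lattice_act g x).
Proof.
rewrite /reduction_act; set x' := repr _.
have /unif_mulP[y xE] : x' - x \in unif_mul L pi.
  by rewrite Quotient.idealrBE /x' reprK.
apply/eqP; rewrite reduce_eq; apply/unif_mulP; exists (lattice_act g y).
apply: val_inj; rewrite /= -linearB -linearZ.
by congr (rho g _); exact: (congr1 val xE).
Qed.

Fact reduction_act_linear g : linear (reduction_act g).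
Proof.
move=> a x y; rewrite -[a]reprK -[x]reduceK -[y]reduceK.
rewrite [_ *: reduce _ _]reduction_scaleE -reduceD !reduction_actE.
rewrite [RHS](congr1 (+%R^~ _) (reduction_scaleE _ _ _)) -reduceD.
by congr (reduce pi _); apply: val_inj; rewrite /= linearP.
Qed.

HB.instance Definition _ g := GRing.isLinear.Build (residue_field w)
  (reduction L pi) (reduction L pi) *:%R (reduction_act g)
  (reduction_act_linear g).

Fact reduction_act1 x : reduction_act 1%g x = x.
Proof.
rewrite -[x]reduceK reduction_actE; congr (reduce pi _).
by apply: val_inj; rewrite /= action1.
Qed.

Fact reduction_actM g h x :
  reduction_act (g * h)%g x = reduction_act g (reduction_act h x).
Proof.
rewrite -[x]reduceK !reduction_actE; congr (reduce pi _).
by apply: val_inj; rewrite /= actionM.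
Qed.

Definition reduction_repr : representation G (reduction L pi) :=
  @Representation _ G (reduction L pi) (fun g => reduction_act g)
    reduction_act1 reduction_actM.

Definition normalised_at (v : V) : Prop :=
  (L : set V) v /\ reduce_vec L pi v <> 0.

End StableLattices.

Section MaximalLattices.
Variables (K : fieldType) (w : discrete_valuation K) (V : vectType K).
Variables (G : groupType) (rho : representation G V) (pi : uniformiser w).

Definition normalised_lattices (v : V) : set (stable_lattice w rho) :=
  [set L | normalised_at pi L v].

Definition maximal_wrt (v : V) (L : stable_lattice w rho) : Prop :=
  normalised_lattices v L /\
  forall M, normalised_lattices v M ->
    (L : set V) `<=` M -> (M : set V) = L.

End MaximalLattices.

Arguments normalised_lattices {K w V G} rho pi v.

(* Main.v *)
(* Write p for the uniformiser. If L is maximal and N is a nonzero submodule of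
   L / p L with preimage N' in L, then p^-1 N' is a stable lattice strictly
   containing L, so it is not normalised at v, which means that N contains the
   image of v. Hence the submodule generated by that image is the least nonzero
   submodule, and it is the socle. Conversely, if M strictly contains L then a
   suitable multiple p^k M, with k > 0, is contained in L and has nonzero image
   in L / p L; that image contains the socle, so v lies in p^k M + p L, which is
   contained in p M, and M is not normalised at v. *)
Require Import Defs.
From HB Require Import structures.
From mathcomp Require Import all_boot all_order all_algebra.
From mathcomp Require Import generic_quotient.
From mathcomp Require Import boolp classical_sets.

Set Implicit Arguments.
Unset Strict Implicit.
Unset Printing Implicit Defensive.

Import Order.TTheory GRing.Theory Num.Theory.
Local Open Scope classical_set_scope.
Local Open Scope ring_scope.

(** * Subspaces of row vectors as row spaces of matrices *)

(** Take [A] of maximal rank among the matrices whose row space lies in [S]: adjoining to [A] a row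
    of [S] cannot raise the rank, so that row is already in the row space. This attaches a rank to a
    submodule given only as a set. *)
Lemma linear_closed_row_space (F : fieldType) (n : nat) (S : set 'rV[F]_n) :
  S 0 -> (forall a x y, S x -> S y -> S (a *: x + y)) ->
  exists A : 'M[F]_n, forall u, S u <-> (u <= A)%MS.
Proof.
move=> S0 SP.
pose inS (A : 'M[F]_n) := forall u : 'rV_n, (u <= A)%MS -> S u.
pose P k := `[< exists2 A, inS A & \rank A = k >].
have exP : exists k, P k.
  exists 0%N; apply/asboolP; exists 0; last exact: mxrank0.
  by move=> u /submx0null ->.
have ubP k : P k -> (k <= n)%N.
  by move=> /asboolP[A _ <-]; apply: rank_leq_row.
case: (ex_maxnP exP ubP) => k /asboolP[A AS rA] kmax.
exists A => u; split=> [Su|]; last exact: AS.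
have AuS : inS (A + u)%MS.
  move=> x /sub_addsmxP[[x1 x2] ->] /=.
  rewrite [x2]mx11_scalar mul_scalar_mx addrC.
  by apply: SP => //; apply: AS; apply: submxMl.
have := kmax _ (introT (asboolP _) (ex_intro2 _ _ _ AuS erefl)).
rewrite -rA => rAu; apply: submx_trans (addsmxSr A u) _.
rewrite -(geq_leqif (mxrank_leqif_sup (addsmxSl A u))).
exact: rAu.
Qed.

(** * Submodules, the socle and irreducible submodules *)

Section Submodule.
Variables (R : pzRingType) (G : groupType) (M : lmodType R).
Variable rho : representation G M.
Implicit Types (N : set M) (x : M).

Lemma submodule0 N : submodule rho N -> N 0.
Proof. by case. Qed.

Lemma submoduleP N a x y : submodule rho N -> N x -> N y -> N (a *: x + y).
Proof. by case=> _ + _; apply. Qed.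

Lemma submodule_sum N n (y : 'I_n -> M) :
  submodule rho N -> (forall i, N (y i)) -> N (\sum_i y i).
Proof.
move=> sN Ny; elim/big_ind: _ => //; first exact: submodule0 sN.
by move=> x z Nx Nz; rewrite -[x]scale1r; apply: submoduleP.
Qed.

Lemma generated_submodule_mem x : generated_submodule rho x x.
Proof. by move=> N []. Qed.

Lemma generated_submoduleP x : submodule rho (generated_submodule rho x).
Proof.
split=> [N [sN _]|a y z Ny Nz N NN|g y Ny N NN].
- exact: submodule0 sN.
- by apply: submoduleP; [case: NN|apply: Ny|apply: Nz].
- by case: (NN) => -[_ _ + _]; apply; apply: Ny.
Qed.

Lemma irreducible_sub_socle N : irreducible_submodule rho N -> N `<=` socle rho.
Proof.
move=> iN x Nx; exists 1%N, (fun=> x); split; last by rewrite big_ord1.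
by move=> _; exists N.
Qed.

(** The submodule generated by [x] lies in every nonzero submodule. It is therefore irreducible, and
    any irreducible submodule must coincide with it. *)
Lemma socle_of_least x : x <> 0 ->
  (forall N, submodule rho N -> N <> [set 0] -> N x) ->
  irreducible_submodule rho (socle rho) /\
  socle rho = generated_submodule rho x.
Proof.
move=> x0 least; set S := generated_submodule rho x.
have S_least N : submodule rho N -> N <> [set 0] -> S `<=` N.
  by move=> sN N0 y; apply; split=> //; apply: least.
have iS : irreducible_submodule rho S.
  split; first exact: generated_submoduleP.
  - by move=> S0; apply: x0; have := @generated_submodule_mem x; rewrite -/S S0.
  move=> N sN NS; have [N0|N0] := EM (N = [set 0]); first by left.
  by right; apply/seteqP; split=> //; apply: S_least.
suff socS : socle rho = S by rewrite socS.
apply/seteqP; split; last exact: irreducible_sub_socle.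
move=> y [n [z [iz ->]]]; apply: submodule_sum.
  exact: generated_submoduleP.
move=> i; have [N [sN N0 Nmin] Nz] := iz i.
have [sS S0 _] := iS.
by have [//|->] := Nmin _ sS (S_least _ sN N0).
Qed.

End Submodule.

(** Descent on dimension: submodules are pulled back along [f] to row spaces, and a nonzero
    submodule of [N] whose pullback has least rank is irreducible. All the pullbacks contain the
    kernel of [f], so their ranks may be compared even if [e] is only a spanning family. *)
Lemma exists_irreducible_submodule (F : fieldType) (G : groupType)
    (M : lmodType F) (rho : representation G M) (n : nat) (e : 'I_n -> M)
    (N : set M) :
  (forall x, exists u : 'rV[F]_n, x = \sum_i u 0 i *: e i) ->
  submodule rho N -> N <> [set 0] ->
  exists2 N', irreducible_submodule rho N' & N' `<=` N.
Proof.
move=> espan sN N0; pose f (u : 'rV[F]_n) := \sum_i u 0 i *: e i.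
have f0 : f 0 = 0 by rewrite /f big1 // => i _; rewrite mxE scale0r.
have fP a x y : f (a *: x + y) = a *: f x + f y.
  rewrite /f scaler_sumr -big_split /=; apply: eq_bigr => i _.
  by rewrite !mxE scalerDl scalerA.
have rowspace N' : submodule rho N' ->
    exists A : 'M[F]_n, forall u, N' (f u) <-> (u <= A)%MS.
  move=> sN'; apply: (@linear_closed_row_space _ _ [set u | N' (f u)]) => /=.
    by rewrite f0; apply: submodule0 sN'.
  by move=> a x y Nx Ny; rewrite fP; apply: (submoduleP _ sN').
pose good k N' (A : 'M[F]_n) := [/\ submodule rho N', N' <> [set 0], N' `<=` N,
  forall u, N' (f u) <-> (u <= A)%MS & \rank A = k].
pose P k := `[< exists N' A, good k N' A >].
have exP : exists k, P k.
  have [A hA] := rowspace _ sN; exists (\rank A); apply/asboolP.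
  by exists N, A; split.
case: (ex_minnP exP) => k /asboolP[N' [A [sN' N'0 N'N hA rA]]] kmin.
exists N' => //; split=> // N1 sN1 N1N'.
have [->|N10] := EM (N1 = [set 0]); first by left.
right; apply/seteqP; split=> //.
have [A1 hA1] := rowspace _ sN1.
have /kmin rA1 : P (\rank A1).
  apply/asboolP; exists N1, A1; split=> //.
  exact: subset_trans N1N' N'N.
have A1A : (A1 <= A)%MS by apply/rV_subP => u /hA1 /N1N' /hA.
(* Minimality of the rank turns the inclusion of row spaces into an equality. *)
have AA1 : (A <= A1)%MS by rewrite -(geq_leqif (mxrank_leqif_sup A1A)) rA.
move=> x; have [u ->] := espan x; rewrite -/(f u) => /hA uA.
by apply/hA1; apply: submx_trans AA1.
Qed.

(** * Clearing denominators with powers of the uniformiser *)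

Section Integrality.
Variables (K : fieldType) (w : discrete_valuation K) (pi : uniformiser w).
Implicit Types (x : K) (n : int).

Lemma val_ge_le m n x : m <= n -> x \in val_ge w n -> x \in val_ge w m.
Proof. by rewrite !inE => mn /orP[->//|nx]; rewrite (le_trans mn nx) orbT. Qed.

Lemma val_ge_self x : x \in val_ge w (w x).
Proof. by rewrite inE lexx orbT. Qed.

Lemma val_ge0_unif : int_val pi \in val_ge w 0.
Proof. exact: valP. Qed.

Lemma val_ge_unifX k : int_val pi ^+ k \in val_ge w k%:Z.
Proof.
elim: k => [|k IHk]; first by rewrite expr0 inE valuation1 lexx orbT.
rewrite exprS -add1n PoszD; apply: val_geM => //.
by rewrite inE unif_val lexx orbT.
Qed.

(** Any [k] at least [- w x] works. All large exponents are covered, so that a finite family has a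
    common one, the maximum. *)
Lemma unifX_integral x :
  exists m : nat, forall k, (m <= k)%N -> int_val pi ^+ k * x \in val_ge w 0.
Proof.
exists `|w x|%N => k mk.
apply: val_ge_le (val_geM (val_ge_unifX k) (val_ge_self x)).
rewrite -lerBlDr sub0r; apply: le_trans (ler_norm _) _.
by rewrite normrN -abszE lez_nat.
Qed.

Lemma unifX_integral_family (I : finType) (c : I -> K) :
  exists m : nat, forall i, int_val pi ^+ m * c i \in val_ge w 0.
Proof.
have [m hm] := choice (fun i => unifX_integral (c i)).
exists (\max_i m i) => i; apply: hm; exact: leq_bigmax.
Qed.

Lemma det_integral d (A : 'M[K]_d) :
  (forall i j, A i j \in val_ge w 0) -> \det A \in val_ge w 0.
Proof.
move=> hA; apply: rpred_sum => s _; rewrite rpredMsign.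
by apply: rpred_prod => i _; apply: hA.
Qed.

End Integrality.

(** Cofactors along row [i] ignore that row, so those of [A] and [B] agree. Expanding [\det B] along
    row [i] thus gives entry [i] of [c *m A *m \adj A], and [A *m \adj A] is the scalar matrix of
    [\det A]. *)
Lemma cramer_row (R : comPzRingType) (n : nat) (A B : 'M[R]_n) (c : 'rV[R]_n)
    (i : 'I_n) :
  row i B = c *m A -> (forall k, k != i -> row k B = row k A) ->
  \det B = c 0 i * \det A.
Proof.
move=> Bi Bk.
have cofE j : cofactor B i j = cofactor A i j.
  rewrite /cofactor; congr (_ * \det _); apply/row_matrixP => k.
  have /Bk/rowP h : lift i k != i by rewrite eq_sym neq_lift.
  by apply/rowP=> l; have := h (lift j l); rewrite !mxE.
have := congr1 (fun C : 'rV_n => C 0 i) (mulmxA c A (\adj A)).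
rewrite mul_mx_adj -Bi mul_mx_scalar !mxE mulrC => ->.
rewrite (expand_det_row B i); apply: eq_bigr => j _.
by rewrite !mxE cofE.
Qed.

(** * Lattices in coordinates, and sets squeezed between lattices *)

Section LatticeBasis.
Variables (K : fieldType) (w : discrete_valuation K) (pi : uniformiser w).
Variable V : vectType K.
Local Notation n := (\dim {:V}).

(** For a basis [X] this is its span over the integers of [K], encoded so that membership is tested
    one coordinate at a time. *)
Definition basis_lattice (X : n.-tuple V) : set V :=
  [set x | forall i, coord X i x \in val_ge w 0].

Lemma basis_lattice_is_lattice (X : n.-tuple V) :
  basis_of fullv X -> is_lattice w (basis_lattice X).
Proof.
move=> bX; have fX := basis_free bX.
exists (fun i : 'I_n => X`_i); split=> [c c0 i|].
  apply: val_inj; exact: (elimT freeP fX (fun i => int_val (c i)) c0 i).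
apply/seteqP; split=> [x hx|_ [c ->] i].
  exists (fun i => Integer (hx i)).
  exact: coord_basis bX (memvf x).
by rewrite coord_sum_free //; apply: valP.
Qed.

(** A linear relation over [K] becomes integral after multiplication by a power of the uniformiser,
    so an integral basis is free over [K]; having [\dim {:V}] members, it is a basis of [V]. *)
Lemma latticeE (L : set V) : is_lattice w L ->
  exists2 X : n.-tuple V, basis_of fullv X & L = basis_lattice X.
Proof.
case=> b [bfree ->]; pose X := [tuple b i | i < n].
have Xi (i : 'I_n) : X`_i = b i by rewrite -tnth_nth tnth_mktuple.
have fX : free X.
  apply/freeP => k k0 i; have [m hm] := unifX_integral_family pi k.
  have /bfree/(_ i)/(congr1 (@int_val _ _))/= : \sum_i
      int_val (Integer (hm i)) *: b i = 0.
    transitivity (int_val pi ^+ m *: \sum_(i < n) k i *: X`_i).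
      rewrite scaler_sumr.
      by apply: eq_bigr => j _; rewrite Xi scalerA.
    by rewrite k0 scaler0.
  by move/eqP; rewrite mulf_eq0 expf_eq0 (negPf (unif_neq0 pi)) andbF => /eqP.
have bX : basis_of fullv X by rewrite basisEfree fX subvf size_tuple leqnn.
exists X => //; apply/seteqP; split=> [_ [c ->] i|x hx].
  under eq_bigr do rewrite -Xi.
  by rewrite coord_sum_free //; apply: valP.
exists (fun i => Integer (hx i)); rewrite [LHS](coord_basis bX (memvf x)).
by apply: eq_bigr => i _; rewrite Xi.
Qed.

Lemma lattice0 (L : set V) : is_lattice w L -> L 0.
Proof.
by case/latticeE => X _ -> i; rewrite linear0 inE eqxx.
Qed.

Lemma latticeP (L : set V) a x y :
  is_lattice w L -> a \in val_ge w 0 -> L x -> L y -> L (a *: x + y).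
Proof.
case/latticeE => X _ -> a0 Lx Ly i; rewrite linearP.
by apply: rpredD (Ly i); apply: rpredM (Lx i).
Qed.

Lemma latticeZ (L : set V) a x :
  is_lattice w L -> a \in val_ge w 0 -> L x -> L (a *: x).
Proof.
move=> latL a0 Lx; rewrite -[_ *: _]addr0; apply: latticeP => //.
exact: lattice0.
Qed.

(** The exponent clears the denominators of the finitely many coordinates of a basis of [M] in a
    basis of [L]. *)
Lemma lattice_unifX_sub (L M : set V) : is_lattice w L -> is_lattice w M ->
  exists m : nat, forall x, M x -> L (int_val pi ^+ m *: x).
Proof.
case/latticeE => X bX -> /latticeE[Y bY ->].
pose c (ij : 'I_n * 'I_n) := coord X ij.2 Y`_ij.1.
have [m hm] := unifX_integral_family pi c; exists m => x Mx i.
rewrite [x](coord_basis bY (memvf x)) scaler_sumr linear_sum.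
apply: rpred_sum => j _; rewrite scalerA mulrC -scalerA !linearZ /=.
by apply: rpredM (Mx j) (hm (j, i)).
Qed.

(* Among the families in N with nonzero determinant relative to L, one whose
   determinant has least valuation is a basis of N: by Cramer's rule a
   coordinate of x in N is the quotient of two such determinants. *)
Lemma lattice_of_between (L N : set V) (a : K) : is_lattice w L -> a != 0 ->
  (forall c x y, c \in val_ge w 0 -> N x -> N y -> N (c *: x + y)) ->
  L `<=` N -> (forall x, N x -> L (a *: x)) -> is_lattice w N.
Proof.
move=> latL a0 NP LN NL; have [X bX LX] := latticeE latL.
pose mx (y : 'I_n -> V) : 'M[K]_n := \matrix_(i, j) coord X j (y i).
(* The factor [a] makes the entries integral for families in [N], so the valuations of nonzero
   determinants are natural numbers and a least one exists. *)
pose D y := \det (a *: mx y).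
have DN y : (forall i, N (y i)) -> D y \in val_ge w 0.
  move=> Ny; apply: det_integral => i j; rewrite !mxE.
  by have := NL _ (Ny i); rewrite LX => /(_ j); rewrite linearZ.
pose P k := `[< exists y, [/\ forall i, N (y i), D y != 0 & w (D y) = k%:Z] >].
have PD y : (forall i, N (y i)) -> D y != 0 -> P `|w (D y)|%N.
  move=> Ny Dy0; apply/asboolP; exists y; split=> //.
  by have := DN _ Ny; rewrite inE (negPf Dy0) /= => /gez0_abs.
have NX (i : 'I_n) : N X`_i.
  apply: LN; rewrite LX => j; rewrite coord_free ?(basis_free bX) //.
  by case: (i == j); rewrite ?rpred1 ?rpred0.
have exP : exists k, P k.
  pose b (i : 'I_n) := X`_i; exists `|w (D b)|%N; apply: PD => //.
  have mxb : mx b = 1%:M.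
    by apply/matrixP=> i j; rewrite !mxE coord_free // (basis_free bX).
  by rewrite /D mxb detZ det1 mulr1 expf_neq0.
case: (ex_minnP exP) => k /asboolP[y [Ny Dy0 wy]] kmin.
have sum_mx (c : 'I_n -> K) j :
    coord X j (\sum_i c i *: y i) = ((\row_i c i) *m mx y) 0 j.
  rewrite linear_sum mxE; apply: eq_bigr => i _.
  by rewrite linearZ !mxE.
pose Y := [tuple y i | i < n].
have Yi (i : 'I_n) : Y`_i = y i by rewrite -tnth_nth tnth_mktuple.
have mxu : mx y \in unitmx.
  by rewrite unitmxE unitfE; move: Dy0; rewrite /D detZ mulf_eq0 negb_or => /andP[].
have fY : free Y.
  apply/freeP => c; under eq_bigr do rewrite Yi; move=> c0 i.
  have : (\row_i c i) *m mx y = 0.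
    by apply/rowP => j; rewrite -sum_mx c0 linear0 mxE.
  move/(congr1 (mulmx^~ (invmx (mx y)))); rewrite mulmxK // mul0mx.
  by move/rowP/(_ i); rewrite !mxE.
have bY : basis_of fullv Y by rewrite basisEfree fY subvf size_tuple leqnn.
suff -> : N = basis_lattice Y by apply: basis_lattice_is_lattice.
apply/seteqP; split=> [x Nx i|x hx]; last first.
  rewrite [x](coord_basis bY (memvf x)).
  elim/big_ind: _ => [|u v Nu Nv|i _].
  - by apply: LN; apply: lattice0.
  - by rewrite -[u]scale1r; apply: NP => //; apply: rpred1.
  - rewrite -[_ *: _]addr0; apply: NP; rewrite ?Yi //.
    by apply: LN; apply: lattice0.
(* Replacing member [i] by [x] multiplies the determinant by [ci]; minimality of [w (D y)] then
   forces [w ci] to be nonnegative when [ci] is nonzero. *)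
pose y' k := if k == i then x else y k.
have Ny' j : N (y' j) by rewrite /y'; case: ifP.
set ci := coord Y i x.
have Dy' : D y' = ci * D y.
  pose c := \row_i coord Y i x.
  rewrite /D !detZ mulrCA; congr (_ * _).
  rewrite (@cramer_row _ _ (mx y) (mx y') c i) ?mxE //.
    apply/rowP=> j; rewrite -sum_mx !mxE /y' eqxx; congr coord.
    rewrite {1}[x](coord_basis bY (memvf x)).
    by apply: eq_bigr => l _; rewrite Yi.
  by move=> l li; apply/rowP=> j; rewrite !mxE /y' (negPf li).
have [->|ci0] := eqVneq ci 0; first exact: rpred0.
have Dy'0 : D y' != 0 by rewrite Dy' mulf_neq0.
have := kmin _ (PD _ Ny' Dy'0); rewrite -lez_nat gez0_abs.
  by rewrite Dy' valuationM // wy inE (negPf ci0) /= lerDr.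
by have := DN _ Ny'; rewrite inE (negPf Dy'0).
Qed.

End LatticeBasis.

(** * The reduction map, read on vectors of the ambient space *)

Section Reduction.
Variables (K : fieldType) (w : discrete_valuation K) (V : vectType K).
Variables (G : groupType) (rho : representation G V) (pi : uniformiser w).
Variable L : stable_lattice w rho.
Implicit Types (x y v : V).
Local Notation red := (reduce_vec L pi).

Lemma stable_lattice_act g x : (L : set V) x -> (L : set V) (rho g x).
Proof. by move=> Lx; rewrite -(stable_latticeP L g); exists x. Qed.

Lemma lat_val_insubd x :
  (L : set V) x -> lat_val (insubd (0 : lattice_elt L) x) = x.
Proof. by move=> Lx; apply: insubdK; apply/lattice_predP. Qed.

(** Membership in [L] is assumed because [reduce_vec] sends every vector outside [L] to the default
    value 0. *)
Lemma reduce_vecP (a : integers w) x y : (L : set V) x -> (L : set V) y ->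
  red (int_val a *: x + y) = (\pi_(residue_field w) a)%qT *: red x + red y.
Proof.
move=> Lx Ly; rewrite [RHS](congr1 (+%R^~ _) (reduction_scaleE _ _ _)) -reduceD.
congr (reduce pi _); apply: val_inj; rewrite /= !lat_val_insubd //.
apply: (latticeP pi) => //; first exact: lattice_is_lattice.
exact: valP.
Qed.

Lemma reduce_vec_act g x : (L : set V) x ->
  red (rho g x) = reduction_repr pi L g (red x).
Proof.
move=> Lx; rewrite /= /reduce_vec reduction_actE; congr (reduce pi _).
apply: val_inj; rewrite /= !lat_val_insubd //.
exact: stable_lattice_act.
Qed.

Lemma reduce_vec_surj (z : reduction L pi) :
  exists2 x, (L : set V) x & z = red x.
Proof.
exists (lat_val (repr z)); first exact/lattice_predP/(valP (repr z)).
by rewrite -[LHS]reduceK /reduce_vec (valKd (0 : lattice_elt L)).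
Qed.

Lemma reduce_vec_eq0 x : (L : set V) x ->
  red x = 0 <-> exists2 y, (L : set V) y & x = int_val pi *: y.
Proof.
move=> Lx; have red0 : reduce pi (0 : lattice_elt L) = 0.
  exact: (raddf0 \pi_(reduction L pi)%qT).
split=> [/eqP|[y Ly xy]].
  rewrite -red0 reduce_eq subr0 => /unif_mulP[y /(congr1 (@lat_val _ _ _ _))].
  rewrite lat_val_insubd // => xy; exists (lat_val y) => //.
  exact/lattice_predP/(valP y).
apply/eqP; rewrite -red0 reduce_eq subr0; apply/unif_mulP.
exists (insubd 0 y); apply: val_inj.
by rewrite /= !lat_val_insubd.
Qed.

Lemma residue_surj (a : residue_field w) :
  exists b : integers w, a = (\pi_(residue_field w) b)%qT.
Proof. by exists (repr a); rewrite reprK. Qed.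

Lemma reduction_spanned :
  exists e : 'I_(\dim {:V}) -> reduction L pi,
    forall z, exists u : 'rV[residue_field w]_(\dim {:V}),
      z = \sum_i u 0 i *: e i.
Proof.
have [b [_ Lb]] := lattice_is_lattice L.
have latL := lattice_is_lattice L.
have Lbi i : (L : set V) (b i).
  rewrite Lb; exists (fun j => (j == i)%:R); rewrite (bigD1 i) //= eqxx scale1r.
  by rewrite big1 ?addr0 // => j /negPf ->; rewrite scale0r.
exists (fun i => red (b i)) => z; have [x Lx ->] := reduce_vec_surj z.
move: (Lx); rewrite {1}Lb => -[c xc].
exists (\row_i (\pi_(residue_field w) (c i))%qT).
(* Membership in [L] is carried through the induction, since [reduce_vecP] requires it of the
   partial sums. *)
suff [] : (L : set V) x /\ red x =
    \sum_i (\pi_(residue_field w) (c i))%qT *: red (b i).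
  by move=> _ ->; apply: eq_bigr => i _; rewrite mxE.
rewrite xc; elim/big_rec2: _ => [|i y1 y2 _ [Ly2 <-]].
  split; first exact: lattice0 latL.
  apply/reduce_vec_eq0; first exact: lattice0 latL.
  by exists 0; [exact: lattice0 latL|rewrite scaler0].
split; first by apply: (latticeP pi latL); rewrite ?(valP (c i)).
by rewrite reduce_vecP.
Qed.

Lemma normalised_atP v : normalised_at pi L v <->
  (L : set V) v /\ ~ exists2 y, (L : set V) y & v = int_val pi *: y.
Proof.
by split=> -[Lv h]; split=> // h'; apply: h; apply/reduce_vec_eq0.
Qed.

End Reduction.

(** * Maximal lattices and the socle of the reduction *)

Section Maximal.
Variables (K : fieldType) (w : discrete_valuation K) (V : vectType K).
Variables (G : groupType) (rho : representation G V) (pi : uniformiser w).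
Implicit Types (L M : stable_lattice w rho) (v : V).
Local Notation p := (int_val pi).

(** The set [M] lies between [L] and [p^-1 L], so [lattice_of_between] applies with [a] equal to
    [p]. *)
Lemma preimage_stable_lattice L (N : set (reduction L pi)) :
  submodule (reduction_repr pi L) N ->
  exists2 M : stable_lattice w rho, (L : set V) `<=` M & forall x,
    (M : set V) x <-> (L : set V) (p *: x) /\ N (reduce_vec L pi (p *: x)).
Proof.
move=> sN; have latL := lattice_is_lattice L.
pose M := [set x | (L : set V) (p *: x) /\ N (reduce_vec L pi (p *: x))].
have LM : (L : set V) `<=` M.
  move=> x Lx; have Lpx : (L : set V) (p *: x).
    by apply: (latticeZ pi latL) => //; apply: val_ge0_unif.
  split=> //; have -> : reduce_vec L pi (p *: x) = 0.
    by apply/reduce_vec_eq0 => //; exists x.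
  exact: submodule0 sN.
have latM : is_lattice w M.
  apply: (lattice_of_between pi latL (unif_neq0 pi)).
  - move=> c x y c0 [Lx Nx] [Ly Ny].
    rewrite /M /= scalerDr scalerA mulrC -scalerA; split.
      exact: (latticeP pi latL).
    rewrite (reduce_vecP pi (Integer c0) Lx Ly).
    exact: (submoduleP _ sN).
  - exact: LM.
  - by move=> x [].
have Mact g x : M x -> M (rho g x).
  move=> [Lx Nx]; rewrite /M /= -linearZ; split.
    exact: stable_lattice_act.
  by rewrite reduce_vec_act //; case: sN => _ _; apply.
(* Stability under [g^-1] upgrades the inclusion to an equality. *)
have stM g : rho g @` Lattice latM = Lattice latM.
  apply/seteqP; split=> [_ [x Mx <-]|x Mx]; first exact: Mact.
  exists (rho g^-1%g x); first exact: Mact.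
  by rewrite -actionM mulgV action1.
by exists (StableLattice stM).
Qed.

Lemma maximal_least_submodule v L (N : set (reduction L pi)) :
  maximal_wrt pi v L -> submodule (reduction_repr pi L) N -> N <> [set 0] ->
  N (reduce_vec L pi v).
Proof.
move=> [[Lv _] maxL] sN N0; apply: contrapT => Nv; apply: N0.
have [M LM hM] := preimage_stable_lattice sN.
(* If [v = p y] with [y] in [M], then the image of [v] would lie in [N]. *)
have Mv : normalised_lattices rho pi v M.
  apply/normalised_atP; split=> [|[y /hM[_ Ny] vy]]; first exact: LM.
  by apply: Nv; rewrite vy.
have ML := maxL _ Mv LM.
apply/seteqP; split=> [z Nz|_ ->]; last exact: submodule0 sN.
have [x Lx zx] := reduce_vec_surj z.
(* A lift [x] of a class in [N] has [p^-1 x] in [M], which equals [L]; hence the class is zero. *)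
have xp : x = p *: (p^-1 *: x) by rewrite scalerA divff ?unif_neq0 ?scale1r.
rewrite zx; apply/reduce_vec_eq0 => //; exists (p^-1 *: x) => //.
by rewrite -ML; apply/hM; rewrite -xp -zx.
Qed.

Lemma image_submodule L (S : set V) :
  S `<=` L -> S 0 ->
  (forall c x y, c \in val_ge w 0 -> S x -> S y -> S (c *: x + y)) ->
  (forall g x, S x -> S (rho g x)) ->
  submodule (reduction_repr pi L) (reduce_vec L pi @` S).
Proof.
move=> SL S0 SP Sact; split.
- exists 0 => //; apply/reduce_vec_eq0; first exact: SL.
  by exists 0; rewrite ?scaler0 //; apply: SL.
- move=> a _ _ [x Sx <-] [y Sy <-]; have [b ->] := residue_surj a.
  exists (int_val b *: x + y); last by rewrite reduce_vecP //; apply: SL.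
  by apply: SP => //; apply: valP.
- move=> g _ [x Sx <-]; exists (rho g x); first exact: Sact.
  by rewrite reduce_vec_act //; apply: SL.
Qed.

Lemma maximal_of_socle v L : normalised_lattices rho pi v L ->
  irreducible_submodule (reduction_repr pi L) (socle (reduction_repr pi L)) ->
  socle (reduction_repr pi L) (reduce_vec L pi v) ->
  maximal_wrt pi v L.
Proof.
move=> Lv [_ _ socmin] socv; split=> // M Mv LM.
have latL := lattice_is_lattice L; have latM := lattice_is_lattice M.
pose P m := `[< forall x, (M : set V) x -> (L : set V) (p ^+ m *: x) >].
have exP : exists m, P m.
  by have [m hm] := lattice_unifX_sub pi latL latM; exists m; apply/asboolP.
(* Least exponent 0 means that [M] is contained in [L], and the two are equal. *)
case: (ex_minnP exP) => -[|k] /asboolP ML kmin.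
  by apply/seteqP; split=> // x /ML; rewrite expr0 scale1r.
exfalso; pose S := [set p ^+ k.+1 *: x | x in (M : set V)].
have sS : submodule (reduction_repr pi L) (reduce_vec L pi @` S).
  apply: image_submodule.
  - by move=> _ [x Mx <-]; apply: ML.
  - by exists 0; rewrite ?scaler0 //; apply: lattice0 latM.
  - move=> c _ _ c0 [x Mx <-] [y My <-].
    exists (c *: x + y); first exact: (latticeP pi latM).
    by rewrite scalerDr !scalerA mulrC.
  - move=> g _ [x Mx <-]; exists (rho g x); last by rewrite linearZ.
    exact: stable_lattice_act.
(* A zero image would put [p^(k+1) M] inside [p L], hence [p^k M] inside [L], against the choice of
   [k.+1]. *)
have S0 : reduce_vec L pi @` S <> [set 0].
  move=> S0; suff /kmin : P k by rewrite ltnn.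
  apply/asboolP => x Mx.
  have : (reduce_vec L pi @` S) (reduce_vec L pi (p ^+ k.+1 *: x)).
    by exists (p ^+ k.+1 *: x) => //; exists x.
  rewrite S0 => /(reduce_vec_eq0 _ (ML _ Mx))[y Ly].
  rewrite exprS -scalerA => /(congr1 ( *:%R p^-1)).
  by rewrite !scalerA mulrA mulVf ?unif_neq0 // mul1r scale1r => ->.
have [e he] := reduction_spanned pi L.
(* An irreducible submodule of the image lies in the irreducible socle, so it is the socle and
   contains the image of [v]. *)
have [N iN NS] := exists_irreducible_submodule he sS S0.
have [sN N0 _] := iN.
have [//|Nsoc] := socmin N sN (irreducible_sub_socle iN).
have /NS[_ [x Mx <-] redx] : N (reduce_vec L pi v) by rewrite Nsoc.
have /normalised_atP[_] := Mv; apply.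
have [Lv0 _] := Lv.
have dE : -1 *: (p ^+ k.+1 *: x) + v = v - p ^+ k.+1 *: x.
  by rewrite scaleN1r addrC.
have N1 : (-1 : K) \in val_ge w 0 by rewrite rpredN rpred1.
have Ld : (L : set V) (v - p ^+ k.+1 *: x).
  by rewrite -dE; apply: (latticeP pi latL) => //; apply: ML.
have : reduce_vec L pi (v - p ^+ k.+1 *: x) = 0.
  rewrite -dE (reduce_vecP pi (Integer N1)) ?redx //; last exact: ML.
  have -> : Integer N1 = -1 by apply: val_inj.
  by rewrite rmorphN rmorph1 scaleN1r addNr.
(* Here [v = p (p^k x + y)] with the bracket in [M], which contradicts normalisation of [M] at
   [v]. *)
case/(reduce_vec_eq0 _ Ld) => y Ly vE; exists (p ^+ k *: x + y).
  apply: (latticeP pi latM) => //; last exact: LM.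
  by apply: val_ge_le (val_ge_unifX pi k).
by rewrite scalerDr scalerA -exprS -vE addrC subrK.
Qed.

End Maximal.

Theorem theorem3p4 (K : fieldType) (w : discrete_valuation K)
    (Kcomplete : valuation_complete w) (pi : uniformiser w)
    (G : groupType) (V : vectType K) (rho : representation G V)
    (v : V) (v_neq0 : v <> 0)
    (L : stable_lattice w rho) (Lv : normalised_lattices rho pi v L) :
  maximal_wrt pi v L <->
  irreducible_submodule (reduction_repr pi L) (socle (reduction_repr pi L)) /\
  socle (reduction_repr pi L)
    = generated_submodule (reduction_repr pi L) (reduce_vec L pi v).
Proof.
split=> [maxL|[isoc socE]].
  apply: socle_of_least; first by case: Lv.
  by move=> N; apply: maximal_least_submodule.
apply: maximal_of_socle => //; rewrite socE.
exact: generated_submodule_mem.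
Qed.
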